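(* The multiplicative extension $\mathcal{M}$, which sends each weakly multiplicative summation $(D,\mathfrak{S})$ to $(\mathcal{M}D,\mathcal{M}\mathfrak{S})$, is a well-defined functor $\mathcal{M}:\mathbf{wMSum}\to\mathbf{MSum}$ and is an idempotent extension map which sends every weakly multiplicative summation to its unique minimal multiplicative extension.
   Context: Let $R$ be a commutative unital ring with $0\neq 1$ and $E$ a commutative unital $R$-algebra with $0\neq 1$. A *summation on $R$ to $E$* is a tuple $(R,E,D,\mathfrak{S})$, abbreviated $(D,\mathfrak{S})$ or $\mathfrak{S}$, where $D$ is a set and $\mathfrak{S}:D\to E$ a map such that: (I) $R[\sigma]\subseteq D\subseteq R[[\sigma]]$; (II) $D$ is an $R$-module and $\mathfrak{S}$ is an $R$-module homomorphism; (III) $\mathfrak{S}(1)=1$; (IV) $(1-\sigma)D\subseteq D$ and $\mathfrak{S}$ factors through $D/(1-\sigma)D$ (i.e. $\mathfrak{S}((1-\sigma)X)=0$ for all $X\in D$). For summations $(D,\mathfrak{S})$, $(D',\mathfrak{S}')$ on the same $R$ to the same $E$, $\mathfrak{S}'$ *extends* $\mathfrak{S}$, written $\mathfrak{S}\subseteq\mathfrak{S}'$, if $D\subseteq D'$ and $\mathfrak{S}'|_D=\mathfrak{S}$. $\mathbf{Sum}$ is the posetal category whose objects are all summations and whose morphisms are extensions. A summation $(D,\mathfrak{S})$ is *multiplicative* if $D$ is an $R$-algebra (a subring of $R[[\sigma]]$) and $\mathfrak{S}$ is an $R$-algebra homomorphism; it is *weakly multiplicative* if it has an extension which is multiplicative.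 $\mathbf{MSum}\subseteq\mathbf{wMSum}$ are the full subcategories of $\mathbf{Sum}$ on the multiplicative and weakly multiplicative summations. A functor $\mathcal{F}:\mathbf{wMSum}\to\mathbf{MSum}$ is an *extension map* if $\mathcal{F}\mathfrak{S}\supseteq\mathfrak{S}$ for every $\mathfrak{S}$, and *idempotent* if $\mathcal{F}\circ\mathcal{F}=\mathcal{F}$. For a weakly multiplicative summation $(D,\mathfrak{S})$ on $R$ to $E$, the *multiplicative extension* $(\mathcal{M}D,\mathcal{M}\mathfrak{S})$ is defined as follows: $X\in R[[\sigma]]$ belongs to $\mathcal{M}D$ iff $X=\sum_{i=1}^{\ell}\prod_{j=1}^{k_i}X_{i,j}$ for some $\ell,k_i\in\mathbb{N}=\{0,1,2,\dots\}$ and $X_{i,j}\in D$; in that case $\mathcal{M}\mathfrak{S}(X):=\sum_{i=1}^{\ell}\prod_{j=1}^{k_i}\mathfrak{S}(X_{i,j})$. *)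

(* Defs.v *)
From HB Require Import structures.
From mathcomp Require Import all_boot all_algebra boolp.

Set Implicit Arguments.
Unset Strict Implicit.
Unset Printing Implicit Defensive.

Import GRing.Theory.
Local Open Scope ring_scope.

Record category := Category {
  ob :> Type;
  hom : ob -> ob -> Type;
  idm : forall x, hom x x;
  comp : forall x y z, hom x y -> hom y z -> hom x z;
  comp1m : forall x y (f : hom x y), comp (idm x) f = f;
  compm1 : forall x y (f : hom x y), comp f (idm y) = f;
  compA : forall x y z t (f : hom x y) (g : hom y z) (h : hom z t),
    comp f (comp g h) = comp (comp f g) h
}.

Record functor (C D : category) := Functor {
  fob :> C -> D;
  fhom : forall x y, hom x y -> hom (fob x) (fob y);
  fhom1 : forall x, fhom (idm x) = idm (fob x);
  fhomM : forall x y z (f : hom x y) (g : hom y z),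
    fhom (comp f g) = comp (fhom f) (fhom g)
}.

Lemma fcomp_hom1 (C D E : category) (G : functor D E) (F : functor C D) x :
  fhom G (fhom F (idm x)) = idm (G (F x)).
Proof. by rewrite !fhom1. Qed.

Lemma fcomp_homM (C D E : category) (G : functor D E) (F : functor C D)
    (x y z : C) (f : hom x y) (g : hom y z) :
  fhom G (fhom F (comp f g)) = comp (fhom G (fhom F f)) (fhom G (fhom F g)).
Proof. by rewrite !fhomM. Qed.

Definition fcomp (C D E : category) (G : functor D E) (F : functor C D) :
    functor C E :=
  Functor (fcomp_hom1 G F) (@fcomp_homM _ _ _ G F).

Definition full (C : category) (P : C -> Prop) : category :=
  @Category {x : C | P x} (fun x y => hom (sval x) (sval y))
    (fun x => idm (sval x)) (fun x y z => @comp C (sval x) (sval y) (sval z))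
    (fun x y => @comp1m C (sval x) (sval y))
    (fun x y => @compm1 C (sval x) (sval y))
    (fun x y z t => @compA C (sval x) (sval y) (sval z) (sval t)).

Definition full_incl (C : category) (P Q : C -> Prop)
    (PQ : forall x, P x -> Q x) : functor (full P) (full Q) :=
  @Functor (full P) (full Q)
    (fun x => exist Q (sval x) (PQ _ (proj2_sig x)))
    (fun _ _ f => f) (fun=> erefl) (fun _ _ _ _ _ => erefl).

Definition posetal (T : Type) (le : T -> T -> Prop)
    (le_refl : forall x, le x x)
    (le_trans : forall x y z, le x y -> le y z -> le x z)
    (le_anti : forall x y, le x y -> le y x -> x = y) : category :=
  @Category T le le_refl le_trans
    (fun _ _ _ => Prop_irrelevance _ _) (fun _ _ _ => Prop_irrelevance _ _)
    (fun _ _ _ _ _ _ _ => Prop_irrelevance _ _).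

(* R[[sigma]], with sigma = fps_of_poly 'X.  A record rather than nat -> R, so
   that products are never read as pointwise products of functions. *)

Record fps (R : comNzRingType) := Fps { fps_coef :> nat -> R }.

HB.instance Definition _ (R : comNzRingType) := gen_eqMixin (fps R).
HB.instance Definition _ (R : comNzRingType) := gen_choiceMixin (fps R).

Section FpsRing.
Variable R : comNzRingType.
Implicit Types X Y Z : fps R.

Definition fps_add X Y := Fps (fun n => X n + Y n).
Definition fps_opp X := Fps (fun n => - X n).
Definition fps_scale (a : R) X := Fps (fun n => a * X n).
Definition fps_mul X Y := Fps (fun n => \sum_(i < n.+1) X i * Y (n - i)%N).
Definition fps_of_poly (p : {poly R}) : fps R := Fps (fun n => p`_n).

Lemma fpsP X Y : (forall n, X n = Y n) -> X = Y.
Proof. by case: X Y => [u] [v] /= /funext ->. Qed.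

Lemma fps_addA : associative fps_add.
Proof. by move=> X Y Z; apply: fpsP => n /=; rewrite addrA. Qed.
Lemma fps_addC : commutative fps_add.
Proof. by move=> X Y; apply: fpsP => n /=; rewrite addrC. Qed.
Lemma fps_add0 : left_id (fps_of_poly 0) fps_add.
Proof. by move=> X; apply: fpsP => n /=; rewrite coef0 add0r. Qed.
Lemma fps_addN : left_inverse (fps_of_poly 0) fps_opp fps_add.
Proof. by move=> X; apply: fpsP => n /=; rewrite coef0 addNr. Qed.

HB.instance Definition _ :=
  GRing.isZmodule.Build (fps R) fps_addA fps_addC fps_add0 fps_addN.

Let tr N X : {poly R} := \poly_(i < N) X i.

Let fps_mul_tr N X Y n : (n < N)%N -> fps_mul X Y n = (tr N X * tr N Y)`_n.
Proof.
move=> ltnN; rewrite coefM /=; apply: eq_bigr => i _.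
have lein : (i <= n)%N by rewrite -ltnS.
by rewrite !coef_poly (leq_ltn_trans lein) // (leq_ltn_trans (leq_subr i n)).
Qed.

Let coefM_eq (p q p' q' : {poly R}) n :
    (forall i, (i <= n)%N -> p`_i = p'`_i) ->
    (forall i, (i <= n)%N -> q`_i = q'`_i) ->
  (p * q)`_n = (p' * q')`_n.
Proof.
move=> ep eq; rewrite !coefM; apply: eq_bigr => i _.
by rewrite ep ?eq ?leq_subr // -ltnS.
Qed.

Let tr_mul N X Y n : (n < N)%N -> (tr N (fps_mul X Y))`_n = (tr N X * tr N Y)`_n.
Proof. by move=> ltnN; rewrite coef_poly ltnN (fps_mul_tr _ _ ltnN). Qed.

Lemma fps_mulA : associative fps_mul.
Proof.
move=> X Y Z; apply: fpsP => n.
rewrite !(@fps_mul_tr n.+1) //.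
transitivity (tr n.+1 X * (tr n.+1 Y * tr n.+1 Z))`_n.
  by apply: coefM_eq => // i lein; rewrite tr_mul.
by rewrite mulrA; apply: coefM_eq => // i lein; rewrite tr_mul.
Qed.
Lemma fps_mulC : commutative fps_mul.
Proof.
by move=> X Y; apply: fpsP => n; rewrite !(@fps_mul_tr n.+1) // mulrC.
Qed.
Lemma fps_mul1 : left_id (fps_of_poly 1) fps_mul.
Proof.
move=> X; apply: fpsP => n /=.
rewrite big_ord_recl /= coef1 mul1r subn0 big1 ?addr0 // => i _.
by rewrite coef1 mul0r.
Qed.
Lemma fps_mulDl : left_distributive fps_mul fps_add.
Proof.
move=> X Y Z; apply: fpsP => n /=; rewrite -big_split /=.
by apply: eq_bigr => i _; rewrite mulrDl.
Qed.
Lemma fps_oner_neq0 : fps_of_poly 1 != 0.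
Proof.
apply/eqP => /(congr1 (fun X : fps R => X 0%N)) /=.
by rewrite coef1 coef0 => /eqP; rewrite oner_eq0.
Qed.

HB.instance Definition _ := GRing.Zmodule_isComNzRing.Build (fps R)
  fps_mulA fps_mulC fps_mul1 fps_mulDl fps_oner_neq0.

Lemma fps_scaleA a b X : fps_scale a (fps_scale b X) = fps_scale (a * b) X.
Proof. by apply: fpsP => n /=; rewrite mulrA. Qed.
Lemma fps_scale1 : left_id 1 fps_scale.
Proof. by move=> X; apply: fpsP => n /=; rewrite mul1r. Qed.
Lemma fps_scaleDr : right_distributive fps_scale +%R.
Proof. by move=> a X Y; apply: fpsP => n /=; rewrite mulrDr. Qed.
Lemma fps_scaleDl X : {morph fps_scale^~ X : a b / a + b}.
Proof. by move=> a b; apply: fpsP => n /=; rewrite mulrDl. Qed.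

HB.instance Definition _ := GRing.Zmodule_isLmodule.Build R (fps R)
  fps_scaleA fps_scale1 fps_scaleDr fps_scaleDl.

Lemma fps_scaleAl (a : R) X Y : a *: (X * Y) = a *: X * Y.
Proof.
apply: fpsP => n /=; rewrite mulr_sumr.
by apply: eq_bigr => i _; rewrite mulrA.
Qed.

HB.instance Definition _ :=
  GRing.Lmodule_isLalgebra.Build R (fps R) fps_scaleAl.
HB.instance Definition _ := GRing.Lalgebra_isComAlgebra.Build R (fps R).

End FpsRing.

(* The elements of an R-submodule D of R[[sigma]], with the induced R-module
   structure.  Membership in D is boolean, but with the classical axioms every
   subset is of this form. *)
Definition elt (R : comNzRingType) (D : submodClosed (fps R)) : Type :=
  {X : fps R | X \in D}.
HB.instance Definition _ R (D : submodClosed (fps R)) := SubChoice.on (elt D).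
HB.instance Definition _ R (D : submodClosed (fps R)) :=
  [SubChoice_isSubLmodule of elt D by <:].

Record summation (R : comNzRingType) (E : comAlgType R) := Summation {
  sdom : submodClosed (fps R);
  smap :> {linear elt sdom -> E};
  sdom_poly : forall p : {poly R}, fps_of_poly p \in sdom;
  smap1 : forall X : elt sdom, val X = 1 -> smap X = 1;
  sdom_1Bsigma : forall X : fps R,
    X \in sdom -> (1 - fps_of_poly 'X) * X \in sdom;
  smap_1Bsigma : forall X Y : elt sdom,
    val Y = (1 - fps_of_poly 'X) * val X -> smap Y = 0
}.

Definition extends (R : comNzRingType) (E : comAlgType R)
    (S S' : summation E) : Prop :=
  {subset sdom S <= sdom S'} /\
  forall (X : elt (sdom S)) (X' : elt (sdom S')), val X = val X' -> S X = S' X'.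

(* R-linearity and preservation of 1 are part of being a summation. *)
Definition multiplicative (R : comNzRingType) (E : comAlgType R)
    (S : summation E) : Prop :=
  subalg_closed (sdom S) /\
  forall X Y XY : elt (sdom S), val XY = val X * val Y -> S XY = S X * S Y.

Definition weakly_multiplicative (R : comNzRingType) (E : comAlgType R)
    (S : summation E) : Prop :=
  exists2 S' : summation E, extends S S' & multiplicative S'.

(* The ring R and the algebra E vary with the summation, and
   only summations on the same R to the same E are related by extension. *)
Record any_summation := AnySummation {
  sring : comNzRingType;
  starget : comAlgType sring;
  underlying : summation starget
}.

Inductive extension : any_summation -> any_summation -> Prop :=
  Extension (R : comNzRingType) (E : comAlgType R) (S S' : summation E) of
    extends S S' : extension (AnySummation S) (AnySummation S').

Lemma submodClosed_eq (R : comNzRingType) (D D' : submodClosed (fps R)) :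
  D =i D' -> D = D'.
Proof.
case: D D' => [p cp] [q cq] /= eqpq.
have {eqpq} epq : p = q by apply: funext => X; apply: eqpq.
case: q / epq cq => cq; congr GRing.SubmodClosed.Pack.
case: cp cq => [[a] [b]] [[a'] [b']].
by rewrite (Prop_irrelevance a a') (Prop_irrelevance b b').
Qed.

Lemma extends_refl (R : comNzRingType) (E : comAlgType R) (S : summation E) :
  extends S S.
Proof. by split=> // X X' /val_inj ->. Qed.

Lemma extends_trans (R : comNzRingType) (E : comAlgType R)
    (S T U : summation E) :
  extends S T -> extends T U -> extends S U.
Proof.
move=> [DST eST] [DTU eTU]; split=> [X /DST /DTU // | X Z eXZ].
by rewrite (eST X (Sub (val X) (DST _ (valP X)))) ?SubK //; apply: eTU.
Qed.

Lemma extends_anti (R : comNzRingType) (E : comAlgType R) (S S' : summation E) :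
  extends S S' -> extends S' S -> S = S'.
Proof.
case: S S' => [D f p1 p2 p3 p4] [D' f' q1 q2 q3 q4] [/= DD' eff'] [/= D'D _].
have eD : D = D' by apply: submodClosed_eq => X; apply/idP/idP; auto.
case: D' / eD f' q1 q2 q3 q4 {DD' D'D} eff' => f' q1 q2 q3 q4 eff'.
have ef : f = f'.
  case: f f' eff' {p2 p4 q2 q4} => [f cf] [f' cf'] /= eff'.
  have e : f = f' by apply: funext => X; apply: eff'.
  case: f' / e cf' {eff'} => cf'; congr GRing.Linear.Pack.
  case: cf cf' => [[a] [b]] [[a'] [b']].
  by rewrite (Prop_irrelevance a a') (Prop_irrelevance b b').
case: f' / ef q2 q4 {eff'} => q2 q4.
by congr Summation; apply: Prop_irrelevance.
Qed.

Lemma extensionP (R : comNzRingType) (E : comAlgType R) (S : summation E) y :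
  extension (AnySummation S) y ->
  exists2 S' : summation E, y = AnySummation S' & extends S S'.
Proof.
pose P x := let: AnySummation _ E T := x in
  exists2 S' : summation E, y = AnySummation S' & extends T S'.
suff: forall x, extension x y -> P x by move/[apply].
move=> x xy; rewrite /P.
by case: x y / xy {P S} => R1 E1 S S' SS'; exists S'.
Qed.

Lemma AnySummation_inj (R : comNzRingType) (E : comAlgType R) :
  injective (@AnySummation R E).
Proof.
pose tag x := existT (fun R : comNzRingType => comAlgType R) _ (starget x).
have tr x y (e : x = y) : underlying y =
    eq_rect (tag x) (fun t => summation (projT2 t)) (underlying x) (tag y)
      (congr1 tag e) by case: y / e.
move=> S S' e; have /= -> := tr _ _ e.
by rewrite (Prop_irrelevance (congr1 tag e) erefl).
Qed.

Lemma extension_refl x : extension x x.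
Proof. by case: x => R E S; split; apply: extends_refl. Qed.

Lemma extension_trans x y z : extension x y -> extension y z -> extension x z.
Proof.
case: x => R E S /extensionP[S' -> SS'] /extensionP[S'' -> SS''].
by split; apply: extends_trans SS''.
Qed.

Lemma extension_anti x y : extension x y -> extension y x -> x = y.
Proof.
case: x => R E S /extensionP[S' -> SS'] /extensionP[S'' /AnySummation_inj <- S'S].
by rewrite (extends_anti SS').
Qed.

Definition Sum : category :=
  posetal extension_refl extension_trans extension_anti.

Definition is_multiplicative (x : Sum) : Prop := multiplicative (underlying x).
Definition is_weakly_multiplicative (x : Sum) : Prop :=
  weakly_multiplicative (underlying x).

Lemma multiplicativeW x : is_multiplicative x -> is_weakly_multiplicative x.
Proof. by exists (underlying x) => //; apply: extends_refl. Qed.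

Definition MSum : category := full is_multiplicative.
Definition wMSum : category := full is_weakly_multiplicative.
Definition MSum_wMSum : functor MSum wMSum := full_incl multiplicativeW.

Definition extension_map (F : functor wMSum MSum) : Prop :=
  forall x : wMSum, extension (sval x) (sval (F x)).

Definition idempotent_map (F : functor wMSum MSum) : Prop :=
  fcomp F (fcomp MSum_wMSum F) = F.

(* Only the Y i j with i < l and j < k i matter; the families
   may be taken total because 0 is an element of sdom S. *)
Definition is_multiplicative_extension (R : comNzRingType) (E : comAlgType R)
    (S T : summation E) : Prop :=
  (forall X : fps R, X \in sdom T <->
    exists (l : nat) (k : nat -> nat) (Y : nat -> nat -> elt (sdom S)),
      X = \sum_(i < l) \prod_(j < k i) val (Y i j)) /\
  (forall (X : elt (sdom T)) (l : nat) (k : nat -> nat)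
      (Y : nat -> nat -> elt (sdom S)),
    val X = \sum_(i < l) \prod_(j < k i) val (Y i j) ->
    T X = \sum_(i < l) \prod_(j < k i) S (Y i j)).

Definition minimal_multiplicative_extension (x : Sum) (y : MSum) : Prop :=
  extension x (sval y) /\
  forall z : MSum, extension x (sval z) -> extension (sval z) (sval y) -> z = y.

(* Main.v *)
From HB Require Import structures.
Require Import Defs.
From mathcomp Require Import all_boot all_algebra.
From mathcomp Require Import boolp.

Set Implicit Arguments.
Unset Strict Implicit.
Unset Printing Implicit Defensive.

Import GRing.Theory.
Local Open Scope ring_scope.

(** Let [S'] be a multiplicative extension of [S : D -> E].  The sums of products
    of elements of [D] form the subalgebra [MD] generated by [D], which lies in
    the domain of [S'], and [S'] is forced on it by the values of [S].  Hence the
    restriction of [S'] to [MD] does not depend on [S'] and is the least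
    multiplicative extension of [S].  Functoriality, idempotence and minimality
    only use this universal property. *)

Section GeneratedSubalgebra.
Variables (R : comNzRingType) (D : submodClosed (fps R)).

(** Lists of lists replace the doubly indexed families: adding sums of products is then
    concatenation, and multiplying them is concatenation over all pairs. *)
Definition sum_prod (s : seq (seq (elt D))) : fps R :=
  \sum_(t <- s) \prod_(Y <- t) val Y.

Definition gen_subalg : {pred fps R} :=
  [pred X | `[< exists s, X = sum_prod s >]].

Lemma gen_subalgP X : reflect (exists s, X = sum_prod s) (X \in gen_subalg).
Proof. exact: asboolP. Qed.

Lemma gen_subalg_familyP X :
  X \in gen_subalg <->
  exists (l : nat) (k : nat -> nat) (Y : nat -> nat -> elt D),
    X = \sum_(i < l) \prod_(j < k i) val (Y i j).
Proof.
split=> [/gen_subalgP[s ->] | [l] [k] [Y] ->]; last first.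
  apply/gen_subalgP.
  exists [seq [seq Y i j | j : 'I_(k i) <- enum 'I_(k i)]
            | i : 'I_l <- enum 'I_l].
  rewrite /sum_prod big_map big_enum /=; apply: eq_bigr => i _.
  by rewrite big_map big_enum.
(* The defaults [[::]] and [0] are read only outside the summation and product ranges. *)
exists (size s), (fun i => size (nth [::] s i)).
exists (fun i j => nth 0 (nth [::] s i) j).
rewrite /sum_prod (big_nth [::]) big_mkord; apply: eq_bigr => i _.
by rewrite (big_nth 0) big_mkord.
Qed.

Lemma sub_gen_subalg : {subset D <= gen_subalg}.
Proof.
move=> X DX; apply/gen_subalgP; exists [:: [:: Sub X DX : elt D]].
by rewrite /sum_prod !big_seq1.
Qed.

Lemma gen_subalg1 : 1 \in gen_subalg.
Proof.
by apply/gen_subalgP; exists [:: [::]]; rewrite /sum_prod big_seq1 big_nil.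
Qed.

Lemma gen_subalgM : GRing.mulr_2closed gen_subalg.
Proof.
move=> _ _ /gen_subalgP[s ->] /gen_subalgP[t ->]; apply/gen_subalgP.
exists [seq u ++ v | u <- s, v <- t].
rewrite /sum_prod big_allpairs_dep big_distrlr /=.
by apply: eq_bigr => u _; apply: eq_bigr => v _; rewrite big_cat.
Qed.

Hypothesis D_poly : forall p : {poly R}, fps_of_poly p \in D.

Lemma gen_subalg_submod : GRing.submod_closed gen_subalg.
Proof.
split=> [|a X Y].
  by apply/gen_subalgP; exists [::]; rewrite /sum_prod big_nil.
(* Scaling by [a] is multiplication by the constant series [a%:A], which lies in [D], so closure
   under products handles it. *)
have aD : a%:A \in gen_subalg.
  by apply: sub_gen_subalg; apply: rpredZ; apply: (D_poly 1).
move=> GX; rewrite -[a *: X]mulr_algl.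
move: (gen_subalgM aD GX) => /gen_subalgP[s ->] /gen_subalgP[t ->].
by apply/gen_subalgP; exists (s ++ t); rewrite /sum_prod big_cat.
Qed.

HB.instance Definition _ :=
  GRing.isSubmodClosed.Build R (fps R) gen_subalg gen_subalg_submod.

Definition gen_submod : submodClosed (fps R) := gen_subalg.

End GeneratedSubalgebra.

Section Restriction.
Variables (R : comNzRingType) (E : comAlgType R) (D D' : submodClosed (fps R)).
Hypothesis DD' : {subset D <= D'}.

Definition elt_incl (X : elt D) : elt D' := Sub (val X) (DD' (valP X)).

Lemma elt_incl_linear : linear elt_incl.
Proof. by move=> a X Y; apply: val_inj. Qed.

HB.instance Definition _ := GRing.isLinear.Build R (elt D) (elt D') _
  elt_incl elt_incl_linear.

Definition restrict (f : {linear elt D' -> E}) : {linear elt D -> E} :=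
  f \o elt_incl.

End Restriction.

Section LeastMultiplicativeExtension.
Variables (R : comNzRingType) (E : comAlgType R).
Implicit Types S T U : summation E.

(** Membership in the domain and the value there are carried together, so that both can be proved by
    one induction on a big operator. *)
Definition sums_to S (X : fps R) (e : E) : Prop :=
  exists2 Y : elt (sdom S), val Y = X & S Y = e.

Lemma sums_toE S (X : elt (sdom S)) e : sums_to S (val X) e -> S X = e.
Proof. by case=> Y /val_inj ->. Qed.

Lemma sums_to_extends S T (X : elt (sdom S)) :
  extends S T -> sums_to T (val X) (S X).
Proof.
case=> DST eST; exists (Sub (val X) (DST _ (valP X))) => //.
by symmetry; apply: eST.
Qed.

(** The value does not mention [T]: every multiplicative extension is forced on sums of products.
    Two expressions of the same series thus have the same value as soon as one such [T] exists. *)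
Lemma sums_to_sum_prod S T l (k : nat -> nat) (Y : nat -> nat -> elt (sdom S)) :
  extends S T -> Defs.multiplicative T ->
  sums_to T (\sum_(i < l) \prod_(j < k i) val (Y i j))
    (\sum_(i < l) \prod_(j < k i) S (Y i j)).
Proof.
move=> ST [[T1 _ TM] eT]; apply: (big_ind2 (sums_to T)).
- by exists 0; rewrite ?linear0.
- by move=> _ _ _ _ [X <- <-] [Z <- <-]; exists (X + Z); rewrite ?linearD.
move=> i _; apply: (big_ind2 (sums_to T)).
(* The empty product, for [k i = 0]. *)
- by exists (Sub 1 T1); last apply: smap1.
- move=> _ _ _ _ [X <- <-] [Z <- <-].
  by exists (Sub (val X * val Z) (TM _ _ (valP X) (valP Z))); last apply: eT.
- by move=> j _; apply: sums_to_extends.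
Qed.

(** Restrict any multiplicative extension [S'] to the subalgebra generated by the domain of [S];
    well-definedness is inherited from [S']. *)
Lemma multiplicative_extension_exists S :
  weakly_multiplicative S ->
  exists2 T : summation E,
    Defs.multiplicative T & is_multiplicative_extension S T.
Proof.
case=> S' SS' mS'; have [[_ _ S'M] eS'] := mS'.
pose MD := gen_submod (sdom_poly S).
have DM : {subset sdom S <= MD} by apply: sub_gen_subalg.
have MD' : {subset MD <= sdom S'}.
  move=> X /gen_subalg_familyP[l [k [Y ->]]].
  by have [Z <- _] := sums_to_sum_prod l k Y SS' mS'; apply: valP.
pose f := restrict MD' S'.
have MD_poly p : fps_of_poly p \in MD by apply/DM/sdom_poly.
have f1 (X : elt MD) : val X = 1 -> f X = 1 by move=> X1; apply: smap1.
have MD_sigma X : X \in MD -> (1 - fps_of_poly 'X) * X \in MD.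
  (* As [MD] is closed under products, it suffices that [1 - fps_of_poly 'X] lies in the domain of
     [S], which contains [1] and is stable under this factor. *)
  move=> MX; apply: gen_subalgM => //; apply: sub_gen_subalg.
  rewrite -[1 - _]mulr1; apply: sdom_1Bsigma; exact: (sdom_poly S 1).
have f_sigma (X Y : elt MD) :
    val Y = (1 - fps_of_poly 'X) * val X -> f Y = 0.
  by move=> XY; apply: smap_1Bsigma (elt_incl MD' X) _ _.
exists (Summation MD_poly f1 MD_sigma f_sigma).
  split; last by move=> X Y XY eXY; apply: eS'.
  split; [exact: gen_subalg1 | | exact: gen_subalgM].
  by case: (gen_subalg_submod (sdom_poly S)).
split=> [X | X l k Y eX]; first exact: gen_subalg_familyP.
apply: (@sums_toE S' (elt_incl MD' X)); rewrite /= eX.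
exact: sums_to_sum_prod.
Qed.

Lemma multiplicative_extension_extends S T :
  is_multiplicative_extension S T -> extends S T.
Proof.
case=> dT eT; split=> [X SX | X X' eX].
  apply/dT; exists 1%N, (fun=> 1%N), (fun _ _ => Sub X SX).
  by rewrite !big_ord1.
by rewrite (eT X' 1%N (fun=> 1%N) (fun _ _ => X)) !big_ord1.
Qed.

Lemma multiplicative_extension_least S T U :
  is_multiplicative_extension S T -> extends S U -> Defs.multiplicative U ->
  extends T U.
Proof.
move=> [dT eT] SU mU; split=> [X /dT[l [k [Y ->]]] | X X' eX].
  by have [Z <- _] := sums_to_sum_prod l k Y SU mU; apply: valP.
have /dT[l [k [Y XY]]] := valP X.
rewrite (eT _ _ _ _ XY); symmetry; apply: sums_toE; rewrite -eX XY.
exact: sums_to_sum_prod.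
Qed.

End LeastMultiplicativeExtension.

Lemma full_sval_inj (C : category) (P : C -> Prop) (x y : full P) :
  sval x = sval y -> x = y.
Proof. by case: x y => [x Px] [y Py] /= e; apply: eq_exist. Qed.

Lemma MSum_hom_irrelevance (x y : MSum) (f g : Defs.hom x y) : f = g.
Proof. exact: (@Prop_irrelevance (extension _ _)). Qed.

(** Morphisms of [MSum] are proofs of a proposition, so a functor into it is determined by its
    objects. *)
Lemma MSum_functor_eq (F G : functor wMSum MSum) :
  (forall x, sval (F x) = sval (G x)) -> F = G.
Proof.
case: F G => [F hF F1 FM] [G hG G1 GM] /= eFG.
have {}eFG : F = G by apply: funext => x; apply: full_sval_inj.
case: G / eFG hG G1 GM => hG G1 GM.
have ehom : hF = hG.
  do 3![apply: functional_extensionality_dep => ?].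
  exact: MSum_hom_irrelevance.
case: hG / ehom G1 GM => G1 GM.
by rewrite (Prop_irrelevance F1 G1) (Prop_irrelevance FM GM).
Qed.

Definition mult_ext_sig (x : wMSum) :=
  cid2 (multiplicative_extension_exists (proj2_sig x)).

Definition mult_ext_ob (x : wMSum) : MSum :=
  exist is_multiplicative (AnySummation (s2val (mult_ext_sig x)))
    (s2valP (mult_ext_sig x)).

Lemma mult_ext_ob_extension x : extension (sval x) (sval (mult_ext_ob x)).
Proof.
have := s2valP' (mult_ext_sig x); rewrite /mult_ext_ob.
(* The chosen witness is generalized, since its type depends on [x]. *)
case: x (mult_ext_sig _) => [[R E S] wS] /= T mT.
by split; apply: multiplicative_extension_extends.
Qed.

Lemma mult_ext_ob_least (x : wMSum) (z : MSum) :
  extension (sval x) (sval z) -> extension (sval (mult_ext_ob x)) (sval z).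
Proof.
have := s2valP' (mult_ext_sig x); rewrite /mult_ext_ob.
case: x (mult_ext_sig _) => [[R E S] wS] /= T mT.
case: z => [z mz] /= /extensionP[U ez SU]; rewrite {}ez in mz *.
by split; apply: multiplicative_extension_least mT SU mz.
Qed.

(** The image of [y] is a multiplicative extension of [y], hence of [x], so it extends the least one
    of [x]. *)
Lemma mult_ext_hom (x y : wMSum) :
  Defs.hom x y -> Defs.hom (mult_ext_ob x) (mult_ext_ob y).
Proof.
move=> xy; apply: mult_ext_ob_least.
exact: extension_trans xy (mult_ext_ob_extension y).
Qed.

Definition mult_ext : functor wMSum MSum :=
  @Functor wMSum MSum mult_ext_ob mult_ext_hom
    (fun _ => MSum_hom_irrelevance _ _)
    (fun _ _ _ _ _ => MSum_hom_irrelevance _ _).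

Lemma mult_ext_idempotent : idempotent_map mult_ext.
Proof.
apply: MSum_functor_eq => x /=; apply: extension_anti.
  (* A multiplicative summation is a multiplicative extension of itself, so it extends its own least
     one. *)
  apply: (@mult_ext_ob_least (MSum_wMSum (mult_ext_ob x)) (mult_ext_ob x)).
  exact: extension_refl.
exact: (mult_ext_ob_extension (MSum_wMSum (mult_ext_ob x))).
Qed.

(** A least element is minimal, and any minimal [y] extends it, hence equals it. *)
Lemma mult_ext_minimal (x : wMSum) :
  unique (minimal_multiplicative_extension (sval x)) (mult_ext x).
Proof.
split=> [|y [xy miny]]; last first.
  apply: miny; first exact: mult_ext_ob_extension.
  exact: mult_ext_ob_least.
split=> [|z xz zM]; first exact: mult_ext_ob_extension.
apply: full_sval_inj; apply: extension_anti zM _.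
exact: mult_ext_ob_least.
Qed.

Theorem theorem4p2 :
  exists M : functor wMSum MSum,
    [/\ forall (R : comNzRingType) (E : comAlgType R) (S : summation E)
            (wmS : is_weakly_multiplicative (AnySummation S)),
          exists2 T : summation E,
            sval (M (exist _ (AnySummation S) wmS)) = AnySummation T
            & is_multiplicative_extension S T,
        extension_map M,
        idempotent_map M
      & forall x : wMSum,
          unique (minimal_multiplicative_extension (sval x)) (M x)].
Proof.
exists mult_ext; split=> [R E S wS|||].
- exists (s2val (mult_ext_sig (exist _ (AnySummation S) wS))) => //.
  exact: (s2valP' (mult_ext_sig (exist _ (AnySummation S) wS))).
- exact: mult_ext_ob_extension.
- exact: mult_ext_idempotent.
- exact: mult_ext_minimal.
Qed.
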